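(* Write $\dfrac{(q;q)_\infty^3}{(q^3;q^3)_\infty^2}=\sum_{n\ge0}a_nq^n$. Then for all $n\ge0$: $a_n>0$ if $n\equiv0\pmod3$, $a_n<0$ if $n\equiv1\pmod3$, and $a_n=0$ if $n\equiv2\pmod3$.
   Context: For $|q|<1$, $(a;q)_\infty=\prod_{k\ge0}(1-aq^k)$. *)

(* Defs.v *)
From mathcomp Require Import all_boot all_order all_algebra.
Set Implicit Arguments. Unset Strict Implicit. Unset Printing Implicit Defensive.
Import Order.TTheory GRing.Theory Num.Theory.
Local Open Scope ring_scope.

(* Formal power series in q with integer coefficients, computed through
   polynomial truncations.  The coefficient of q^n of
     (q;q)_oo^3 / (q^3;q^3)_oo^2
   = prod_{k>=1} (1-q^k)^3 * prod_{k>=1} (sum_{j>=0} q^(3kj))^2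
   only depends on the factors with k <= n and on the geometric terms with
   j <= n, so it equals the n-th coefficient of the polynomial [eta_trunc n]. *)

Definition qpoch_fin (N : nat) : {poly int} := \prod_(1 <= k < N.+1) (1 - 'X^k).

Definition geom_trunc (m N : nat) : {poly int} := \sum_(j < N.+1) 'X^(m * j).

Definition eta_trunc (N : nat) : {poly int} :=
  qpoch_fin N ^+ 3 * (\prod_(1 <= k < N.+1) geom_trunc (3 * k) N) ^+ 2.

Definition a (n : nat) : int := (eta_trunc n)`_n.

(* Main.v *)
Require Import Defs.
From mathcomp Require Import all_boot all_order all_algebra.
From mathcomp Require Import qpoly ring zify.
Set Implicit Arguments. Unset Strict Implicit. Unset Printing Implicit Defensive.
Import Order.TTheory GRing.Theory Num.Theory.
Local Open Scope ring_scope.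

(** Write phi(q) = (q;q)_oo and y = q^3.  Splitting the exponents j(j+1)/2 of
    Jacobi's series for phi(q)^3 modulo 3 gives
      phi(q)^3 = P(y) - 3 q phi(y^3)^3,
      P(y) = sum_(m in Z) (-1)^m (6m+1) y^(m(3m+1)/2),
    and differentiating the triple product of modulus 3 with respect to its
    free variable gives P(y) = phi(y) (1 + 6 (1 - y) L(y)) with
      L(y) = sum_k y^(3k+1) / ((1 - y^(3k+1)) (1 - y^(3k+2))).
    Hence the series is
      (1 + 6 (1 - y) L(y)) / phi(y)  -  3 q phi(y^3)^3 / phi(y)^2.
    In the first term 1 - y cancels a factor of phi(y).  In the second the
    factors pair up as
      (1 - uv) / ((1 - u)(1 - v)) = 1/(1 - u) + v/(1 - v).
    So both are 1/(1 - y) plus a series in y with nonnegative coefficients.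

    Power series modulo q^M are elements of a commutative ring with an x such
    that x^M = 0; long enough finite products then stand for infinite ones. *)

(** * Gaussian binomials and finite products (q;q)_N *)

Section GaussianBinomials.
Variables (R : comNzRingType) (q : R).

Fixpoint qbinom (n k : nat) : R :=
  match n, k with
  | _, 0 => 1
  | 0, _.+1 => 0
  | n'.+1, k'.+1 => qbinom n' k' + q ^+ k'.+1 * qbinom n' k'.+1
  end.

Definition qpoch (N : nat) : R := \prod_(k < N) (1 - q ^+ k.+1).

Lemma qbinom0 n : qbinom n 0 = 1. Proof. by case: n. Qed.

Lemma qbinomS n k :
  qbinom n.+1 k.+1 = qbinom n k + q ^+ k.+1 * qbinom n k.+1.
Proof. by []. Qed.

Lemma qbinom_small n k : (n < k)%N -> qbinom n k = 0.
Proof.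
elim: n k => [|n IHn] [|k] // ltnk.
by rewrite qbinomS !IHn ?mulr0 ?addr0 // ltnW.
Qed.

(** The mirror of the defining q-Pascal rule. [coef_triple] needs one rule for each of the two kinds
    of factors. *)
Lemma qbinomSr n k : (k <= n)%N ->
  qbinom n.+1 k.+1 = q ^+ (n - k) * qbinom n k + qbinom n k.+1.
Proof.
elim: n k => [|n IHn] [|k] // lekn; first by rewrite /= !mulr1 mulr0.
- by rewrite qbinomS {1}IHn // qbinomS !qbinom0 !subn0 !exprS; ring.
move: lekn; rewrite ltnS leq_eqVlt => /orP[/eqP->|ltkn].
  by rewrite qbinomS subnn [qbinom n.+1 n.+2]qbinom_small // [qbinom n.+1 n.+1]qbinomS; ring.
rewrite qbinomS {1}(IHn k) 1?ltnW // {1}(IHn k.+1) // [qbinom n.+1 k.+1]qbinomS.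
rewrite [qbinom n.+1 k.+2]qbinomS.
have -> : (n.+1 - k.+1 = (n - k.+1).+1)%N by lia.
have -> : (n - k = (n - k.+1).+1)%N by lia.
by rewrite !exprS; ring.
Qed.

(** The quotient formula cleared of denominators. For k > n both sides vanish, the right one through
    the factor 1 - q^0. *)
Lemma qbinomM_qpoch n k : qbinom n k * qpoch k = \prod_(i < k) (1 - q ^+ (n - i)).
Proof.
have small m j : (m < j)%N -> \prod_(i < j) (1 - q ^+ (m - i)) = 0.
  by move=> ltmj; rewrite (bigD1 (Ordinal ltmj)) //= subnn expr0 subrr mul0r.
elim: n k => [|n IHn] [|k]; rewrite /qpoch ?big_ord0 ?qbinom0 ?mulr1 //.
  by rewrite small // mul0r.
rewrite qbinomS mulrDl -mulrA IHn -/(qpoch k.+1) /qpoch big_ord_recr /= -/(qpoch k).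
rewrite mulrA IHn [RHS]big_ord_recl [X in _ + _ * X]big_ord_recr /= subn0.
have [lekn|ltnk] := leqP k n; last first.
  by rewrite small //; ring.
have -> : q ^+ n.+1 = q ^+ k.+1 * q ^+ (n - k) by rewrite -exprD; congr (_ ^+ _); lia.
rewrite [X in _ = _ * X](eq_bigr (fun i : 'I_k => 1 - q ^+ (n - i))) //; ring.
Qed.

Lemma prod_absorb (c : R) (I : Type) (s : seq I) (P : pred I) (F : I -> R) :
  (forall i, P i -> c * F i = c) -> c * \prod_(i <- s | P i) F i = c.
Proof. by move=> cF; elim/big_rec: _ => [|i y /cF cFi IH]; rewrite ?mulr1 // mulrA cFi. Qed.

Lemma mulr_expr_eq0W (c : R) i j : (i <= j)%N -> c * q ^+ i = 0 -> c * q ^+ j = 0.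
Proof. by move=> /subnKC<- c0; rewrite exprD mulrA c0 mul0r. Qed.

Lemma qpoch_absorb c m N : (m <= N)%N -> c * q ^+ m.+1 = 0 ->
  c * qpoch N = c * qpoch m.
Proof.
move=> lemN c0; rewrite /qpoch -!(big_mkord xpredT (fun k => 1 - q ^+ k.+1)).
rewrite (@big_cat_nat _ _ _ m) //= mulrCA [RHS]mulrC; congr (_ * _).
rewrite big_seq; apply: prod_absorb => i; rewrite mem_index_iota => /andP[lemi _].
by rewrite mulrBr mulr1 (mulr_expr_eq0W _ c0) ?subr0.
Qed.

(** For k and n - k large, a Gaussian binomial tends to 1/(q;q)_oo. Here [c] makes this exact by
    absorbing the factors 1 - q^(n-i), whose exponents exceed n - k. *)
Lemma qbinom_absorb c n k N : (k <= n)%N -> q ^+ N.+1 = 0 ->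
  c * q ^+ k.+1 = 0 -> c * q ^+ (n - k).+1 = 0 ->
  c * (qbinom n k * qpoch N) = c.
Proof.
move=> lekn qN ck cnk; rewrite mulrCA.
have -> : c * qpoch N = c * qpoch k.
  have [leNk|ltkN] := leqP N k; last exact: qpoch_absorb (ltnW ltkN) ck.
  by rewrite (@qpoch_absorb c N k) // qN mulr0.
rewrite mulrCA qbinomM_qpoch; apply: prod_absorb => i _.
rewrite mulrBr mulr1 (@mulr_expr_eq0W c (n - k).+1) ?subr0 //.
by have := ltn_ord i; lia.
Qed.

End GaussianBinomials.

Arguments qbinom {R} q n k : simpl never.

(** * The Jacobi triple product, finite and truncated *)

Section TripleProduct.
Variables (R : comNzRingType) (x : R) (d r : nat).
Hypotheses (d_gt0 : (0 < d)%N) (ler : (r <= d)%N).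

(* With j = i - b in Z, this is d j(j-1)/2 + r j. *)
Definition texp (b i : nat) : nat :=
  if (b <= i)%N then (d * 'C(i - b, 2) + r * (i - b))%N
  else (d * 'C((b - i).+1, 2) - r * (b - i))%N.

Lemma texp_ge b j : texp b (b + j) = (d * 'C(j, 2) + r * j)%N.
Proof. by rewrite /texp leq_addr addKn. Qed.

Lemma texp_le b j : (j <= b)%N -> texp b (b - j) = (d * 'C(j.+1, 2) - r * j)%N.
Proof.
case: j => [|j] lejb; first by rewrite subn0 /texp leqnn subnn !bin_small // !muln0.
rewrite /texp ifN -?ltnNge ?subKn //; lia.
Qed.

Lemma texpS b i : (texp b i.+1 + d * b = texp b i + d * i + r)%N.
Proof.
have [lebi|ltib] := leqP b i.
  have [j ->] : exists j, (i = b + j)%N by exists (i - b)%N; lia.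
  by rewrite -addnS !texp_ge binS bin1; nia.
have [j [-> lej]] : exists j, (i = b - j.+1 /\ j.+1 <= b)%N by exists (b - i).-1; lia.
have -> : ((b - j.+1).+1 = b - j)%N by lia.
rewrite !texp_le //; last by lia.
rewrite (binS j.+1) bin1; have : (j <= 'C(j.+1, 2))%N by rewrite binS bin1; lia.
by nia.
Qed.

(** The factors 1 - x^e / z of the usual product are multiplied by z = 'X to stay polynomial, which
    shifts the powers of z by [b]. *)
Definition triple (a b : nat) : {poly R} :=
  \prod_(k < a) (1 - (x ^+ (d * k + r))%:P * 'X)
  * \prod_(k < b) ('X - (x ^+ (d * k.+1 - r))%:P).

(** The q-binomial theorem in shifted form. Induction on [b] for a = 0, then on [a]; each new factor
    matches a q-Pascal rule. *)
Lemma coef_triple a b i :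
  (triple a b)`_i = (-1) ^+ (i + b) * qbinom (x ^+ d) (a + b) i * x ^+ texp b i.
Proof.
elim: a b i => [|a IHa].
  elim=> [|b IHb] i.
    rewrite /triple !big_ord0 mulr1 coef1 !addn0.
    case: i => [|i]; last by rewrite mulr0 mul0r.
    by rewrite /texp leqnn subnn bin_small // !muln0 !expr0 qbinom0 !mulr1.
  have -> : triple 0 b.+1 = triple 0 b * ('X - (x ^+ (d * b.+1 - r))%:P).
    by rewrite /triple [in LHS]big_ord_recr /= mulrA.
  rewrite mulrBr coefB coefMX coefMC !IHb !add0n.
  have eS j : x ^+ texp b j.+1 * x ^+ (d * b.+1 - r) = x ^+ d ^+ j.+1 * x ^+ texp b.+1 j.+1.
    rewrite -exprM -!exprD; congr (_ ^+ _).
    have -> : texp b.+1 j.+1 = texp b j by rewrite /texp ltnS subSS.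
    have := texpS b j; nia.
  case: i => [|i].
    rewrite !qbinom0 !mulr1 sub0r -mulrA -exprD addnS exprS mulN1r mulNr !add0n.
    congr (- (_ * x ^+ _)); have := texpS b.+1 0.
    have -> : texp b.+1 1 = texp b 0 by rewrite /texp /= ltnS subSS.
    nia.
  rewrite /= -[X in _ - X]mulrA eS qbinomS.
  have -> : texp b.+1 i.+1 = texp b i by rewrite /texp ltnS subSS.
  rewrite !addSn !addnS !exprS; ring.
move=> b i.
have -> : triple a.+1 b = triple a b * (1 - (x ^+ (d * a + r))%:P * 'X).
  rewrite /triple [in LHS]big_ord_recr /=; ring.
rewrite mulrBr mulr1 coefB mulrA coefMX coefMC !IHa.
case: i => [|i]; first by rewrite subr0 !qbinom0.
rewrite !addSn [X in _ - X]/=.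
have [lein|ltni] := leqP i (a + b); last first.
  have small j n : (n < j)%N -> qbinom (x ^+ d) n j = 0 by exact: qbinom_small.
  rewrite (small i.+1 (a + b)%N) ?(small i (a + b)%N) ?(small i.+1 (a + b).+1) //; last by lia.
  by ring.
rewrite qbinomSr //.
have eS : x ^+ texp b i * x ^+ (d * a + r) = x ^+ d ^+ (a + b - i) * x ^+ texp b i.+1.
  rewrite -exprM -!exprD; congr (_ ^+ _); have := texpS b i; nia.
rewrite -[X in _ - X]mulrA eS.
by rewrite !exprS; ring.
Qed.

Lemma size_triple a b : (size (triple a b) <= (a + b).+1)%N.
Proof.
by apply/leq_sizeP => j ltj; rewrite coef_triple qbinom_small // mulr0 mul0r.
Qed.

(** With [leq_texpr], this gives the annihilation hypotheses of [qbinom_absorb] for c = x^(texp b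
    i). The key is j <= C(j,2) + 1. *)
Lemma leq_texpl M a b i : (M <= a)%N -> (M <= b)%N -> (i <= a + b)%N ->
  (M <= texp b i + d * (a + b - i).+1)%N.
Proof.
move=> leMa leMb lei; have [lebi|ltib] := leqP b i; last by nia.
have [j ij] : exists j, (i = b + j)%N by exists (i - b)%N; lia.
rewrite ij texp_ge; have : (j <= 'C(j, 2).+1)%N.
  by case: j {ij} => [|[|j]] //; rewrite binS bin1; lia.
by nia.
Qed.

Lemma leq_texpr M b i : (M <= b)%N -> (M <= texp b i + d * i.+1)%N.
Proof.
move=> leMb; have [lebi|ltib] := leqP b i; first by nia.
have [j [ij lej]] : exists j, (i = b - j /\ j <= b)%N by exists (b - i)%N; lia.
rewrite ij texp_le //; have : (j <= 'C(j, 2).+1)%N.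
  by case: j {ij lej} => [|[|j]] //; rewrite binS bin1; lia.
by rewrite binS bin1; nia.
Qed.

Hypothesis (M : nat) (xM : x ^+ M = 0).

Lemma expr_nil m : (M <= m)%N -> x ^+ m = 0.
Proof. by move=> /subnKC<-; rewrite exprD xM mul0r. Qed.

(* Once a, b >= M the Gaussian binomials are killed by the prefactor, which
   leaves the Jacobi triple product. *)
Lemma coef_triple_nil a b N i : (M <= a)%N -> (M <= b)%N -> (M <= N)%N ->
  (i <= a + b)%N ->
  ((qpoch (x ^+ d) N)%:P * triple a b)`_i = (-1) ^+ (i + b) * x ^+ texp b i.
Proof.
move=> leMa leMb leMN lei; rewrite coefCM coef_triple.
set c := x ^+ texp _ _; set Q := qbinom _ _ _.
transitivity ((-1) ^+ (i + b) * (c * (Q * qpoch (x ^+ d) N))); first by ring.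
rewrite qbinom_absorb //.
- by rewrite -exprM expr_nil //; nia.
- by rewrite -exprM -exprD expr_nil //; exact: leq_texpr.
by rewrite -exprM -exprD expr_nil //; exact: leq_texpl.
Qed.

Lemma triple_eval a b N : (M <= a)%N -> (M <= b)%N -> (M <= N)%N ->
  qpoch (x ^+ d) N * (triple a b).[1] =
  \sum_(i < (a + b).+1) (-1) ^+ (i + b) * x ^+ texp b i.
Proof.
move=> leMa leMb leMN; rewrite -hornerCM.
rewrite (@horner_coef_wide _ (a + b).+1); last first.
  by rewrite mul_polyC (leq_trans (size_scale_leq _ _)) // size_triple.
by apply: eq_bigr => i _; rewrite expr1n mulr1 coef_triple_nil // -ltnS.
Qed.

Lemma triple_deriv a b N : (M <= a)%N -> (M <= b)%N -> (M <= N)%N ->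
  qpoch (x ^+ d) N * (triple a b)^`().[1] =
  \sum_(i < (a + b).+1) (-1) ^+ (i + b) * i%:R * x ^+ texp b i.
Proof.
move=> leMa leMb leMN; rewrite -hornerCM -deriv_mulC.
have szp : (size (((qpoch (x ^+ d) N)%:P * triple a b))%R <= (a + b).+1)%N.
  by rewrite mul_polyC (leq_trans (size_scale_leq _ _)) // size_triple.
rewrite (@horner_coef_wide _ (a + b)); last first.
  by apply/leq_sizeP => j lej; rewrite coef_deriv (nth_default _ (leq_trans szp _)) ?mul0rn.
rewrite big_ord_recl mulr0 mul0r add0r.
apply: eq_bigr => i _; rewrite expr1n mulr1 coef_deriv coef_triple_nil //.
by rewrite mulrAC mulr_natr.
Qed.

End TripleProduct.

(** * Jacobi's series and its dissection modulo 3 *)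

Section Sums.
Variable R : comNzRingType.
Implicit Types (x : R) (n K : nat).

(** Cuts a sum over j = i - b in Z into j < 0, read outwards, and j >= 0. *)
Lemma sum_fold (F : nat -> R) b c :
  \sum_(i < b + c) F i = \sum_(j < b) F (b - j.+1)%N + \sum_(j < c) F (b + j)%N.
Proof.
by rewrite big_split_ord /= (reindex_inj rev_ord_inj).
Qed.

Lemma eq_sign m n : odd m = odd n -> (-1) ^+ m = (-1) ^+ n :> R.
Proof. by move=> eqmn; rewrite -signr_odd eqmn signr_odd. Qed.

Definition jacobi_sum x n : R :=
  \sum_(j < n) (-1) ^+ j * (j.*2.+1)%:R * x ^+ 'C(j.+1, 2).

(* The terms m = j and m = -(j+1) of the series P of the header. *)
Definition pent_sum x K : R :=
  \sum_(j < K.+1) (-1) ^+ j * (6 * j + 1)%:R * x ^+ (3 * 'C(j, 2) + 2 * j)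
  + \sum_(j < K) (-1) ^+ j * (6 * j + 5)%:R * x ^+ (3 * 'C(j.+2, 2) - 2 * j.+1).

Lemma bin2_mul3 n : 'C(3 * n, 2) = (9 * 'C(n, 2) + 3 * n)%N.
Proof.
elim: n => // n IHn; have -> : (3 * n.+1 = (3 * n).+3)%N by lia.
rewrite !binS !bin1 !bin0 IHn; lia.
Qed.

(** For j = 3k+1, C(j+1,2) = 9 C(k+1,2) + 1 and 2j+1 = 3(2k+1); for j = 3k and 3k+2 the exponent is
    a multiple of 3. With 3K + 1 terms the cut-offs match exactly. *)
Lemma jacobi_dissection x K :
  jacobi_sum x (3 * K).+1 =
  pent_sum (x ^+ 3) K - 3%:R * x * jacobi_sum (x ^+ 9) K.
Proof.
elim: K => [|K IHK].
  by rewrite /jacobi_sum /pent_sum !big_ord1 !big_ord0 /= !bin_small //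
     !muln0 add0n !expr0 !mulr0 addr0 subr0.
have -> : jacobi_sum x (3 * K.+1).+1 = jacobi_sum x (3 * K).+1
   + (-1) ^+ (3 * K).+1 * ((3 * K).+1.*2.+1)%:R * x ^+ 'C((3 * K).+2, 2)
   + (-1) ^+ (3 * K).+2 * ((3 * K).+2.*2.+1)%:R * x ^+ 'C((3 * K).+3, 2)
   + (-1) ^+ (3 * K).+3 * ((3 * K).+3.*2.+1)%:R * x ^+ 'C((3 * K).+4, 2).
  have -> : (3 * K.+1 = (3 * K).+3)%N by lia.
  by rewrite /jacobi_sum !big_ord_recr.
rewrite IHK /pent_sum [X in _ = X + _ - _]big_ord_recr.
rewrite [X in _ = _ + X - _]big_ord_recr [jacobi_sum _ K.+1]big_ord_recr /=.
rewrite -/(jacobi_sum (x ^+ 9) K) -!exprM.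
rewrite -[((3 * K).+3)]addn3 -[((3 * K).+2)]addn2 -[((3 * K).+1)]addn1.
have sgn c e : odd (3 * K + c) = odd (K + e) -> (-1) ^+ (3 * K + c) = (-1) ^+ (K + e) :> R.
  exact: eq_sign.
rewrite (sgn 1%N 1%N) ?(sgn 2%N 0%N) ?(sgn 3%N 1%N); try by lia.
set e1 := 'C(_, _); set e2 := 'C(_, _); set e3 := 'C(_, _).
set f1 := (3 * (_ + _))%N; set f2 := (3 * (_ - _))%N; set f3 := (9 * _)%N.
have b3 := bin2_mul3 K.
have -> : e1 = f3.+1 by rewrite /e1 /f3 !addn2 !binS !bin1 !bin0 b3; lia.
have -> : e2 = f2 by rewrite /e2 /f2 !addn3 !binS !bin1 !bin0 b3; lia.
have -> : e3 = f1 by rewrite /e3 /f1 !addn3 !binS !bin1 !bin0 b3; lia.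
rewrite addn0 addn1 (exprS x f3) (exprS _ K) -!muln2.
clearbody f1 f2 f3; move: (\sum_(i < K.+1) _) (\sum_(i < K) _) => s1 s2; ring.
Qed.

End Sums.

(** * Inverses, Jacobi's identity and the series P *)

Section Geom.
Variables (R : comNzRingType) (x : R) (M : nat).
Hypothesis xM : x ^+ M = 0.

(* The inverse of 1 - x^m for m > 0; geom 0 is M%:R. *)
Definition geom m : R := \sum_(j < M) x ^+ (m * j).

Lemma geomK m : (0 < m)%N -> (1 - x ^+ m) * geom m = 1.
Proof.
move=> m_gt0; rewrite /geom (eq_bigr (fun j : 'I_M => (x ^+ m) ^+ j)) => [|j _]; last first.
  by rewrite exprM.
by rewrite -[1 - _]opprB mulNr -subrX1 -exprM mulnC exprM xM
           expr0n; case: m m_gt0 => // m _; rewrite sub0r opprK.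
Qed.

Lemma geomE m : (0 < m)%N -> geom m = 1 + x ^+ m * geom m.
Proof. by move=> /geomK <-; ring. Qed.

Definition qpochV N : R := \prod_(k < N) geom k.+1.

Lemma qpochK N : qpoch x N * qpochV N = 1.
Proof. by rewrite -big_split big1 // => k _ /=; rewrite geomK. Qed.

Lemma qpoch_stable N N' : (M <= N.+1)%N -> (M <= N'.+1)%N -> qpoch x N = qpoch x N'.
Proof.
move=> leMN leMN'; wlog leNN' : N N' leMN leMN' / (N <= N')%N.
  by move=> IH; have [/IH->|/ltnW/IH->] := leqP N N'.
rewrite -[RHS]mul1r (@qpoch_absorb _ _ 1 N) ?mul1r //; exact: expr_nil leMN.
Qed.

(** With d = 1 and r = 0 the first factor is 1 - 'X, so the derivative of the triple product at 1 is
    minus the product of the other factors. *)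
Lemma jacobi N : (M <= N)%N -> qpoch x N ^+ 3 = jacobi_sum x N.+1.
Proof.
move=> leMN.
have := @triple_deriv R x 1 0 isT isT M xM N.+1 N N (leqW leMN) leMN leMN.
rewrite expr1 /triple big_ord_recl /= muln0 expr0 mul1r -[in LHS]mulrA.
have deriv1 (p : {poly R}) : ((1 - 'X) * p)^`().[1] = - p.[1].
  by rewrite derivM derivB derivC derivX sub0r hornerD !hornerM hornerN
             hornerD hornerN hornerX hornerC; ring.
rewrite deriv1 hornerM !horner_prod.
rewrite (eq_bigr (fun k : 'I_N => 1 - x ^+ k.+1)) => [|k _]; last first.
  by rewrite mul1n addn0 !hornerE.
rewrite [X in - (_ * X)](eq_bigr (fun k : 'I_N => 1 - x ^+ k.+1)) => [|k _]; last first.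
  by rewrite mul1n subn0 !hornerE.
rewrite -/(qpoch x N) -addnS => e3.
rewrite (_ : _ ^+ 3 = - (qpoch x N * (- (qpoch x N * qpoch x N)))); last by ring.
(* Cutting at N + 1 pairs i = N - j with i = N + j + 1: same exponent C(j+1,2), opposite signs,
   weights differing by 2j+1. *)
rewrite e3 (sum_fold (fun i => (-1) ^+ (i + N) * i%:R * x ^+ texp 1 0 N i)).
rewrite -big_split -sumrN; apply: eq_bigr => j _ /=; have := ltn_ord j; rewrite ltnS => lejN.
rewrite subSS addSnnS texp_ge texp_le // !mul1n mul0n addn0 subn0.
rewrite (@eq_sign _ (N - j + N) j) ?(@eq_sign _ (N + j.+1 + N) j.+1); try lia.
rewrite exprS natrB // !natrD -muln2 -[j.+1]addn1 -[(_ * 2).+1]addn1 natrD natrD natrM; ring.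
Qed.

(** [l k] is the logarithmic derivative of [F k] at 1, stated without division. *)
Lemma deriv_prod1 (F : nat -> {poly R}) (l : nat -> R) K :
  (forall k, (F k)^`().[1] = (F k).[1] * l k) ->
  (\prod_(k < K) F k)^`().[1] = (\prod_(k < K) F k).[1] * \sum_(k < K) l k.
Proof.
move=> Fl; elim: K => [|K IHK]; first by rewrite !big_ord0 derivC horner0 mulr0.
by rewrite !big_ord_recr /= derivM hornerD !hornerM IHK Fl; ring.
Qed.

Definition lambert K : R :=
  \sum_(k < K) x ^+ (3 * k).+1 * geom (3 * k).+1 * geom (3 * k).+2.

Lemma qpoch_mul3 K :
  qpoch x (3 * K) = qpoch (x ^+ 3) K *
  \prod_(k < K) ((1 - x ^+ (3 * k).+1) * (1 - x ^+ (3 * k).+2)).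
Proof.
elim: K => [|K IHK]; first by rewrite muln0 /qpoch !big_ord0 mulr1.
have -> : qpoch x (3 * K.+1) = qpoch x (3 * K) * (1 - x ^+ (3 * K).+1)
    * (1 - x ^+ (3 * K).+2) * (1 - x ^+ (3 * K).+3).
  have -> : (3 * K.+1 = (3 * K).+3)%N by lia.
  by rewrite /qpoch !big_ord_recr.
have -> : x ^+ (3 * K).+3 = x ^+ 3 ^+ K.+1 by rewrite -exprM; congr (_ ^+ _); lia.
rewrite IHK [qpoch _ K.+1]big_ord_recr big_ord_recr /= -/(qpoch (x ^+ 3) K); ring.
Qed.

Lemma pentagonal K : (M <= K)%N ->
  qpoch x (3 * K) * (1 + 6%:R * (1 - x) * lambert K) = pent_sum x K.
Proof.
move=> leMK.
have e0 := @triple_eval R x 3 2 isT isT M xM K K K leMK leMK leMK.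
have := @triple_deriv R x 3 2 isT isT M xM K K K leMK leMK leMK.
set T := triple _ _ _ _ _ in e0 *.
pose u k : {poly R} := (1 - (x ^+ (3 * k + 2))%:P * 'X) * ('X - (x ^+ (3 * k.+1 - 2))%:P).
have TE : T = \prod_(k < K) u k by rewrite big_split.
have expE k : (3 * k.+1 - 2 = (3 * k).+1)%N by lia.
have u1 k : (u k).[1] = (1 - x ^+ (3 * k).+1) * (1 - x ^+ (3 * k).+2).
  by rewrite /u expE addn2 hornerM !hornerD !hornerN hornerCM hornerX !hornerC; ring.
(* With p = x^(3k+1), the logarithmic derivative of [u k] at 1 is 1/(1-p) - xp/(1-xp) = 1 +
   (1-x)p/((1-p)(1-xp)). *)
pose l k := 1 + (1 - x) * (x ^+ (3 * k).+1 * geom (3 * k).+1 * geom (3 * k).+2).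
have du k : (u k)^`().[1] = (u k).[1] * l k.
  rewrite u1 /u expE addn2 derivM !derivB deriv_mulC derivX !derivC hornerD !hornerM.
  rewrite !hornerD !hornerN !hornerM ?hornerX !hornerC /l.
  have := @geomK (3 * k).+1 isT; have := @geomK (3 * k).+2 isT.
  rewrite [x ^+ (3 * k).+2]exprS; set p := x ^+ _; set g1 := geom _; set g2 := geom _ => h2 h1.
  transitivity ((1 - p) * (1 - x * p) + (1 - x) * p * ((1 - p) * g2) * ((1 - x * p) * g1)).
    by rewrite h1 h2; ring.
  by ring.
have -> : T^`().[1] = T.[1] * (K%:R + (1 - x) * lambert K).
  rewrite TE (deriv_prod1 _ du); congr (_ * _).
  by rewrite /l big_split sumr_const card_ord mulr_sumr.
move=> e1; have T1 : qpoch (x ^+ 3) K * T.[1] = qpoch x (3 * K).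
  by rewrite qpoch_mul3 TE horner_prod; congr (_ * _); apply: eq_bigr => k _.
(* Since i = K + m with m in Z, the weight 6m+1 is 6i + (1 - 6K): six times the derivative plus 1 -
   6K times the value. *)
transitivity (6%:R * (qpoch (x ^+ 3) K * (T.[1] * (K%:R + (1 - x) * lambert K)))
   + (1 - (6 * K)%:R) * (qpoch (x ^+ 3) K * T.[1])).
  by rewrite -T1 natrM; ring.
rewrite e1 e0 -addnS.
rewrite (sum_fold (fun i => (-1) ^+ (i + K) * i%:R * x ^+ texp 3 2 K i)).
rewrite (sum_fold (fun i => (-1) ^+ (i + K) * x ^+ texp 3 2 K i)).
rewrite /pent_sum addrC !mulrDr !mulr_sumr addrACA -!big_split /= [RHS]addrC.
congr (_ + _); apply: eq_bigr => j _.
  have ltjK := ltn_ord j; rewrite texp_le //.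
  rewrite (@eq_sign _ (K - j.+1 + K) j.+1); last by lia.
  rewrite exprS natrB //. Show. ring.
rewrite texp_ge (@eq_sign _ (K + j + K) j); last by lia.
Show. ring.
Qed.

End Geom.

(** * Lower bounds for coefficients in y *)

Section Positivity.
Variables (R : comNzRingType) (y : R) (M : nat).
Hypothesis yM : y ^+ M = 0.

(* The values at y of the polynomials with natural coefficients. *)
Inductive nnegX : R -> Prop :=
| nnegX0 : nnegX 0
| nnegX1 : nnegX 1
| nnegXX : nnegX y
| nnegXD a b : nnegX a -> nnegX b -> nnegX (a + b)
| nnegXM a b : nnegX a -> nnegX b -> nnegX (a * b).

Lemma nnegX_exp m : nnegX (y ^+ m).
Proof.
elim: m => [|m IHm]; first by rewrite expr0; exact: nnegX1.
by rewrite exprS; apply: nnegXM => //; exact: nnegXX.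
Qed.

Lemma nnegX_sum (I : Type) (s : seq I) (F : I -> R) :
  (forall i, nnegX (F i)) -> nnegX (\sum_(i <- s) F i).
Proof. by move=> F0; apply: big_ind => // [|a b]; [exact: nnegX0 | exact: nnegXD]. Qed.

Lemma nnegX_prod (I : Type) (s : seq I) (F : I -> R) :
  (forall i, nnegX (F i)) -> nnegX (\prod_(i <- s) F i).
Proof. by move=> F0; apply: big_ind => // [|a b]; [exact: nnegX1 | exact: nnegXM]. Qed.

Lemma nnegX_nat m : nnegX m%:R.
Proof.
by elim: m => [|m IHm]; [exact: nnegX0 | rewrite -addn1 natrD; apply: nnegXD => //; exact: nnegX1].
Qed.

Local Notation g := (geom y M).
Local Notation G := (qpochV y M).

Lemma nnegX_geom m : nnegX (g m).
Proof. by apply: nnegX_sum => j; exact: nnegX_exp. Qed.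

(** Stands for the coefficientwise inequality c <= a of series in y, in a ring without an order. *)
Definition coef_ge (c a : R) : Prop := exists2 b, nnegX b & a = c + b.

Lemma coef_geDr c a b : coef_ge c a -> nnegX b -> coef_ge c (a + b).
Proof. by move=> [a' a'0 ->] b0; exists (a' + b); [exact: nnegXD | rewrite addrA]. Qed.

Lemma coef_geM c a b : nnegX c -> coef_ge c a -> coef_ge 1 b -> coef_ge c (a * b).
Proof.
move=> c0 [a' a'0 ->] [b' b'0 ->]; exists (c * b' + a' + a' * b'); last by ring.
by do ![exact: nnegXM | apply: nnegXD].
Qed.

Lemma coef_ge_prod (I : Type) (s : seq I) (F : I -> R) :
  (forall i, coef_ge 1 (F i)) -> coef_ge 1 (\prod_(i <- s) F i).
Proof.
move=> F1; apply: big_ind => // [|a b].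
  by exists 0; [exact: nnegX0 | rewrite addr0].
by apply: coef_geM; exact: nnegX1.
Qed.

Lemma coef_ge_geom m : (0 < m)%N -> coef_ge 1 (g m).
Proof.
move=> m_gt0; exists (y ^+ m * g m); last exact: geomE.
by apply: nnegXM; [exact: nnegX_exp | exact: nnegX_geom].
Qed.

Lemma coef_ge_geom1 : coef_ge (g 1) (g 1).
Proof. by exists 0; [exact: nnegX0 | rewrite addr0]. Qed.

Lemma qpochV_stable N N' : (M <= N.+1)%N -> (M <= N'.+1)%N -> G N = G N'.
Proof.
move=> leMN leMN'; rewrite -[LHS]mulr1 -(qpochK yM N') -(qpoch_stable yM leMN leMN').
by rewrite mulrA [G N * _]mulrC (qpochK yM) mul1r.
Qed.

Lemma coef_ge_lambert N K :
  coef_ge (g 1) ((1 + 6%:R * (1 - y) * lambert y M K) * G N.+1).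
Proof.
have -> : G N.+1 = g 1 * \prod_(k < N) g k.+2 by rewrite /qpochV big_ord_recl.
set P := \prod_(k < N) _; have P1 : coef_ge 1 P by apply: coef_ge_prod => k; exact: coef_ge_geom.
have L0 : nnegX (lambert y M K).
  apply: nnegX_sum => k; apply: nnegXM; last exact: nnegX_geom.
  by apply: nnegXM; [exact: nnegX_exp | exact: nnegX_geom].
have P0 : nnegX P by apply: nnegX_prod => k; exact: nnegX_geom.
have := geomK yM (isT : (0 < 1)%N); rewrite expr1 => g1K.
(* The factor 1 - y, the only one with a negative coefficient, meets its inverse g 1. *)
rewrite [X in coef_ge _ X]
  (_ : _ = g 1 * P + 6%:R * lambert y M K * P * ((1 - y) * g 1)); last by ring.
rewrite g1K mulr1; apply: coef_geDr.
  by apply: coef_geM => //; [exact: nnegX_geom | exact: coef_ge_geom1].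
by do ![exact: nnegX_nat | apply: nnegXM].
Qed.

(* a k + b k = 3 (k + 1), and over k < 2 K each exponent 1 or 2 mod 3 below 3 K
   occurs twice, except that 2 occurs only once and 3 K + 2 occurs once. *)
Let a k := (3 * k./2).+1.
Let b k := (3 * uphalf k).+2.

Lemma geom_pair k : (1 - y ^+ (3 * k.+1)) * g (a k) * g (b k) = g (a k) + y ^+ b k * g (b k).
Proof.
have -> : y ^+ (3 * k.+1) = y ^+ a k * y ^+ b k.
  rewrite -exprD; congr (_ ^+ _); rewrite /a /b uphalf_half; have := odd_double_half k.
  by rewrite -muln2; lia.
have ea := geomK yM (isT : (0 < a k)%N); have eb := geomK yM (isT : (0 < b k)%N).
transitivity (((1 - y ^+ b k) * g (b k)) * g (a k)
  + y ^+ b k * g (b k) * ((1 - y ^+ a k) * g (a k))).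
  by ring.
by rewrite ea eb; ring.
Qed.


(** The extra g 2 supplies the missing copy of exponent 2. Each step uses the exponents 3K+1 twice,
    3K+2 and 3K+5. *)
Lemma qpoch_pairing K :
  (\prod_(k < 2 * K) ((1 - y ^+ (3 * k.+1)) * g (a k) * g (b k))) * g 2 =
  qpoch (y ^+ 3) (2 * K) * (\prod_(i < K) (g (3 * i).+1 * g (3 * i).+2)) ^+ 2 * g (3 * K).+2.
Proof.
elim: K => [|K IHK]; first by rewrite /qpoch !big_ord0 expr1n !mul1r.
have -> : (2 * K.+1 = (2 * K).+2)%N by lia.
rewrite !big_ord_recr /qpoch !big_ord_recr /= -/(qpoch (y ^+ 3) (2 * K)).
rewrite -!exprM.
have -> : a (2 * K) = (3 * K).+1 by rewrite /a mul2n doubleK.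
have -> : b (2 * K) = (3 * K).+2 by rewrite /b mul2n uphalf_double.
have -> : a (2 * K).+1 = (3 * K).+1 by rewrite /a mul2n /= uphalf_double.
have -> : b (2 * K).+1 = (3 * K.+1).+2 by rewrite /b mul2n /= doubleK.
set P := \prod_(i < 2 * K) _ in IHK *; set Q := \prod_(i < K) _ in IHK *.
set u := 1 - _; set v := 1 - _; set g5 := g (3 * K.+1).+2.
transitivity (P * g 2 * (u * v * g (3 * K).+1 ^+ 2 * g (3 * K).+2 * g5)); first by ring.
by rewrite IHK; ring.
Qed.

(** Since 1/phi(y) = Q / phi(y^3), with Q collecting the exponents prime to 3, the quotient is
    phi(y^3) Q^2, to which the pairing applies. *)
Lemma coef_ge_cube N N' : (M <= N)%N -> (M <= N')%N ->
  coef_ge (g 1) (qpoch (y ^+ 3) N ^+ 3 * G N' ^+ 2).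
Proof.
move=> leMN leMN'; have y3M : (y ^+ 3) ^+ M = 0 by rewrite -exprM mulnC exprM yM expr0n.
pose K := M.+1; pose Q := \prod_(i < K) (g (3 * i).+1 * g (3 * i).+2).
have GE : G N' = Q * qpochV (y ^+ 3) M K.
  rewrite (@qpochV_stable _ (3 * K)); try by rewrite ?/K; lia.
  rewrite /Q; elim: K {Q} => [|K IHK]; first by rewrite /qpochV muln0 !big_ord0 mulr1.
  have -> : (3 * K.+1 = (3 * K).+3)%N by lia.
  rewrite /qpochV !big_ord_recr /= -!/(qpochV _ _ _) IHK.
  have -> : geom (y ^+ 3) M K.+1 = g (3 * K).+3.
    apply: eq_bigr => j _; rewrite -exprM; congr (_ ^+ _); lia.
  by ring.
have Kok m : (0 < m)%N -> (M <= (m * K).+1)%N by rewrite /K; nia.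
have e2 : qpoch (y ^+ 3) N = qpoch (y ^+ 3) (2 * K).
  by apply: (qpoch_stable y3M); [exact: leqW | exact: Kok].
have e1 : qpoch (y ^+ 3) (2 * K) * qpochV (y ^+ 3) M K = 1.
  rewrite (@qpoch_stable _ _ _ y3M (2 * K) K) ?Kok //; last by rewrite /K; lia.
  exact: qpochK.
have gK : g (3 * K).+2 = 1.
  rewrite geomE // (expr_nil yM) ?mul0r ?addr0 // /K; lia.
rewrite e2 GE.
set V := qpochV _ _ _ in e1 *; set F := qpoch _ _ in e1 *.
rewrite [X in coef_ge _ X](_ : _ = F * Q ^+ 2 * (F * V) ^+ 2); last by ring.
(* The closing factor g(3K+2) of the pairing is 1, so it can be inserted. *)
rewrite e1 expr1n -gK -qpoch_pairing.
have -> : (2 * K = (2 * M).+1.+1)%N by rewrite /K; lia.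
(* The pair k = 0 is g 1 + y^2 g 2 and supplies the bound g 1; every other factor is at least 1. *)
rewrite big_ord_recl geom_pair -mulrA; apply: coef_geM; first exact: nnegX_geom.
  apply: coef_geDr; first exact: coef_ge_geom1.
  by apply: nnegXM; [exact: nnegX_exp | exact: nnegX_geom].
apply: coef_geM; first exact: nnegX1; last exact: coef_ge_geom.
apply: coef_ge_prod => k; rewrite geom_pair; apply: coef_geDr; first exact: coef_ge_geom.
by apply: nnegXM; [exact: nnegX_exp | exact: nnegX_geom].
Qed.

End Positivity.

(** The header's formula where x^M = 0: in the P term one of the two inverses of phi(y) cancels
    phi(y). *)
Lemma eta_quotient_split (R : comNzRingType) (x : R) (M N : nat) :
  x ^+ M = 0 -> (M <= N.+1)%N ->
  exists s t, [/\ nnegX (x ^+ 3) s, nnegX (x ^+ 3) t &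
    qpoch x N ^+ 3 * qpochV (x ^+ 3) M N ^+ 2 =
    (geom (x ^+ 3) M 1 + s) - 3%:R * x * (geom (x ^+ 3) M 1 + t)].
Proof.
move=> xM leMN; set y := x ^+ 3; pose K := M.+1.
have powM m : (0 < m)%N -> (x ^+ m) ^+ M = 0.
  by move=> m_gt0; rewrite -exprM mulnC exprM xM expr0n; case: m m_gt0.
have yM : y ^+ M = 0 by exact: powM.
have y3E : x ^+ 9 = y ^+ 3 by rewrite -exprM.
have [s s0 sE] := coef_ge_lambert yM M K.
have [t t0 tE] := coef_ge_cube yM (leqnn M) (leqnSn M).
exists s, t; split=> //; rewrite -sE -tE.
rewrite (@qpochV_stable _ _ _ yM N K) //; last by rewrite /K; lia.
rewrite (@qpoch_stable _ _ _ xM N (3 * K)) //; last by rewrite /K; lia.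
rewrite (jacobi xM) ?jacobi_dissection; last by rewrite /K; lia.
rewrite -(pentagonal yM) -/y ?y3E -?(jacobi (M := M)) -?y3E ?powM //.
have GK : qpoch y (3 * K) * qpochV y M K = 1.
  by rewrite (@qpoch_stable _ _ _ yM (3 * K) K) ?(qpochK yM) // /K; lia.
set G := qpochV _ _ _ in GK *; set L := lambert _ _ _; set F := qpoch _ (3 * K) in GK *.
set J := qpoch _ M.
transitivity ((F * G) * ((1 + 6%:R * (1 - y) * L) * G) - 3%:R * x * (J ^+ 3 * G ^+ 2)).
  by ring.
by rewrite GK mul1r.
Qed.

(** * Return to integer polynomials, modulo X^(n+1) *)

Section Truncation.
Variable n : nat.
Local Notation trunc := (in_qpoly ('X^(n.+1) : {poly int})).
Local Notation x := (trunc 'X).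

Lemma trunc_coef (p q : {poly int}) i : trunc p = trunc q -> (i <= n)%N -> p`_i = q`_i.
Proof.
move=> /(congr1 val) /=; rewrite mk_monic_Xn /= -!Pdiv.RingMonic.take_poly_rmodp => eqpq lein.
by have := congr1 (fun r : {poly int} => r`_i) eqpq; rewrite !coef_take_poly ltnS lein.
Qed.

Lemma truncX_nil : x ^+ n.+1 = 0.
Proof.
rewrite -rmorphXn; apply: val_inj => /=.
by rewrite mk_monic_Xn /= Pdiv.RingMonic.rmodpp // monicXn.
Qed.

Lemma trunc_eta :
  trunc (eta_trunc n) = qpoch x n ^+ 3 * qpochV (x ^+ 3) n.+1 n ^+ 2.
Proof.
rewrite /eta_trunc rmorphM !rmorphXn !rmorph_prod big_add1 !big_mkord.
congr (_ ^+ 3 * _ ^+ 2).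
  by rewrite /qpoch; apply: eq_bigr => k _; rewrite rmorphB rmorph1 rmorphXn.
rewrite big_add1 big_mkord; apply: eq_bigr => k _; rewrite /geom_trunc rmorph_sum.
by apply: eq_bigr => j _; rewrite rmorphXn -exprM mulnA.
Qed.

(** Induction on the closure rules: composition with 'X^3 and truncation respect sums and
    products. *)
Lemma nnegX_lift r : nnegX (x ^+ 3) r ->
  exists p : {poly int}, (forall i, 0 <= p`_i) /\ r = trunc (p \Po 'X^3).
Proof.
elim=> [||| a b _ [p [p0 ->]] _ [q [q0 ->]] | a b _ [p [p0 ->]] _ [q [q0 ->]]].
- by exists 0; split=> [i|]; rewrite ?coef0 // comp_poly0 rmorph0.
- by exists 1; split=> [i|]; rewrite ?coef1 ?ler0n // comp_polyC rmorph1.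
- by exists 'X; split=> [i|]; rewrite ?coefX ?ler0n // comp_polyX rmorphXn.
- exists (p + q); split=> [i|]; first by rewrite coefD addr_ge0.
  by rewrite comp_polyD rmorphD.
exists (p * q); split=> [i|]; last by rewrite comp_polyM rmorphM.
by rewrite coefM sumr_ge0 // => j _; rewrite mulr_ge0.
Qed.

Lemma eta_trunc_split : exists p q : {poly int},
  [/\ forall i, (i <= n)%N -> 0 < p`_i, forall i, (i <= n)%N -> 0 < q`_i &
      forall i, (i <= n)%N ->
      (eta_trunc n)`_i = (p \Po 'X^3 - ('X * (q \Po 'X^3)) *+ 3)`_i].
Proof.
have [s [t [/nnegX_lift[p [p0 ->]] /nnegX_lift[q [q0 ->]] splitE]]] :=
  eta_quotient_split truncX_nil (leqnn n.+1).
(* 1 + 'X + ... + 'X^n represents 1/(1 - y); its coefficients 1 make nonnegativity strict up to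
   degree n. *)
pose u : {poly int} := \poly_(i < n.+1) 1.
have uE : geom (x ^+ 3) n.+1 1 = trunc (u \Po 'X^3).
  rewrite /u poly_def raddf_sum rmorph_sum; apply: eq_bigr => i _ /=.
  by rewrite scale1r comp_Xn_poly mul1n !rmorphXn.
have upos (r : {poly int}) i : (forall j, 0 <= r`_j) -> (i <= n)%N -> 0 < (u + r)`_i.
  by move=> r0 lein; rewrite coefD coef_poly ltnS lein ltr_wpDr.
exists (u + p), (u + q); split=> [i|i|i lein]; try exact: upos.
apply: trunc_coef lein; rewrite trunc_eta splitE uE !comp_polyD.
by rewrite rmorphB rmorphMn rmorphM !rmorphD -[in LHS]mulrA [in LHS]mulr_natl.
Qed.

End Truncation.

Theorem theorem1p3 (n : nat) :
  [/\ (n %% 3 = 0)%N -> 0 < a n,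
      (n %% 3 = 1)%N -> a n < 0
    & (n %% 3 = 2)%N -> a n = 0].
Proof.
have [p [q [p0 q0 /(_ n (leqnn n))]]] := eta_trunc_split n.
(* The first term contributes p_(n/3) when 3 divides n, the second -3 q_((n-1)/3) when n = 1 mod
   3. *)
rewrite -/(a n) coefB coefMn coefXM !coef_comp_poly_Xn // /dvdn => ->.
split=> n3; first last.
- by case: n n3 {p0 q0} => // n n3; rewrite n3 /= (_ : n %% 3 = 1)%N ?mul0rn ?subr0 //; lia.
- case: n n3 p0 q0 => // n n3 p0 q0; rewrite n3 /= (_ : n %% 3 = 0)%N /=; last by lia.
  by rewrite sub0r oppr_lt0 pmulrn_lgt0 // q0 //; lia.
rewrite n3 /= (_ : (if n == 0%N then 0 else _) = 0) ?mul0rn ?subr0 ?p0 //.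
  by rewrite leq_div.
by case: n n3 {p0 q0} => // n n3; rewrite /= (_ : n %% 3 = 2)%N //; lia.
Qed.
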